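(* Let $\Gamma$ be a distance-regular graph with diameter $D\geq 3$, valency $k$, and intersection number $c_2$. Assume that every local graph of $\Gamma$ is strongly regular with smallest eigenvalue $-m$, where $m\geq 3$, and that the triple intersection number $\gamma(\Gamma)$ exists. Then the following (i) and (ii) hold. (i) If every local graph of $\Gamma$ is the block graph of an orthogonal array and $k>m^2$, then $c_2\neq m^2$. (ii) If every local graph of $\Gamma$ is the block graph of a Steiner system and $k>m(m+1)$, then $c_2\neq m(m+1)$.
   Context: Graphs $\Gamma$ are finite, undirected, connected and simple; $\partial$ is the path-length distance, $\Gamma_i(x)=\{y:\partial(x,y)=i\}$, $\Gamma(x)=\Gamma_1(x)$. A connected graph $\Gamma$ with diameter $D$ is distance-regular if for all $0\le h,i,j\le D$ and all vertices $x,y$ with $\partial(x,y)=h$ the number $p^h_{i,j}=|\Gamma_i(x)\cap\Gamma_j(y)|$ depends only on $h,i,j$; write $c_i=p^i_{1,i-1}$, $a_i=p^i_{1,i}$, $b_i=p^i_{1,i+1}$ and $k=b_0$ (the valency). The local graph of $\Gamma$ at a vertex $x$ is the subgraph induced on $\Gamma(x)$. A regular graph with $\nu$ vertices and valency $\kappa$ is strongly regular with parameters $(\nu,\kappa,\lambda,\mu)$ if every two adjacent vertices have exactly $\lambda$ common neighbors and every two distinct nonadjacent vertices have exactly $\mu$ common neighbors. Eigenvalues of a graph are those of its adjacency matrix. The triple intersection number $\gamma(\Gamma)$ exists if there is at least one triple of vertices $(x,y,z)$ with $x,y$ adjacent and $\partial(x,z)=\partial(y,z)=2$ (i.e. $a_2\neq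 0$), and for every such triple the number of common neighbors of $x$, $y$, $z$ is the same constant, denoted $\gamma(\Gamma)$. An orthogonal array $\operatorname{OA}(p,q)$ is a $p\times q^2$ array with entries in $\{1,\ldots,q\}$ such that the columns of every $2\times q^2$ subarray (formed by two rows) contain each of the $q^2$ ordered pairs exactly once. Its block graph has the columns as vertices, two distinct columns being adjacent if and only if there is a row in which they have the same entry. A Steiner system $S(2,p,q)$ is a $2$-$(q,p,1)$ design: a collection of $p$-subsets (blocks) of a $q$-set (of points) such that every pair of distinct points is contained in exactly one block. Its block graph has the blocks as vertices, two blocks being adjacent if and only if they intersect in exactly one point. *)

(* Defs.v *)
From HB Require Import structures.
From mathcomp Require Import all_boot all_order all_algebra.

Set Implicit Arguments.
Unset Strict Implicit.
Unset Printing Implicit Defensive.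

Record sgraph := SGraph {
  vert :> finType;
  adj : rel vert;
  adj_sym : symmetric adj;
  adj_irr : irreflexive adj
}.

Definition isomorphic (G H : sgraph) : Prop :=
  exists f : G -> H, bijective f /\ forall x y, adj (f x) (f y) = adj x y.

Section Distance.
Variable G : sgraph.
Implicit Types x y : G.

Definition connected : Prop := forall x y, connect (@adj G) x y.

Definition walk (n : nat) x y : bool :=
  [exists p : n.-tuple G, path (@adj G) x p && (last x p == y)].

(* A shortest walk has length < #|G|; if there is no walk from x to y,
   the value is #|G|. *)
Definition dist x y : nat := find (fun n => walk n x y) (iota 0 #|G|).

Definition diameter : nat := \max_(x : G) \max_(y : G) dist x y.

Definition sphere (i : nat) x : {set G} := [set y | dist x y == i].

Definition nbrs x : {set G} := [set y | adj x y].

Lemma sphere1 x : sphere 1 x = nbrs x.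
Proof.
have walk0 y : walk 0 x y = (x == y).
  apply/existsP/idP => [[p]|/eqP<-]; first by rewrite tuple0.
  by exists [tuple]; rewrite /= eqxx.
have walk1 y : walk 1 x y = adj x y.
  apply/existsP/idP => [[p]|xy].
    by case/tupleP: p => z p; rewrite tuple0 /= andbT => /andP[xz /eqP<-].
  by exists [tuple y]; rewrite /= xy eqxx.
apply/setP=> y; rewrite !inE /dist.
have [cG|cG] := ltnP 1 #|G|.
  case: #|G| cG => [|[|n]] //= _; rewrite walk0 walk1.
  case: (eqVneq x y) => [<-|_]; first by rewrite adj_irr.
  by case: (adj x y).
have -> : y = x by apply: (card_le1_eqP cG).
have: 0 < #|G| by apply/card_gt0P; exists x.
by case: #|G| => //= n _; rewrite walk0 eqxx adj_irr.
Qed.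

End Distance.

(* p h i j is p^h_{i,j}; its values outside 0 <= h, i, j <= D are irrelevant. *)
Definition distance_regular (G : sgraph) (p : nat -> nat -> nat -> nat) : Prop :=
  connected G /\
  forall h i j : nat,
    h <= diameter G -> i <= diameter G -> j <= diameter G ->
    forall x y : G, dist x y = h -> #|sphere i x :&: sphere j y| = p h i j.

Definition inter_c (p : nat -> nat -> nat -> nat) (i : nat) : nat := p i 1 i.-1.
Definition inter_b (p : nat -> nat -> nat -> nat) (i : nat) : nat := p i 1 i.+1.
Definition valency (p : nat -> nat -> nat -> nat) : nat := inter_b p 0.

Section Induced.
Variables (G : sgraph) (A : {set G}).

Definition induced_adj : rel {x : G | x \in A} := fun u v => adj (val u) (val v).

Lemma induced_sym : symmetric induced_adj.
Proof. by move=> u v; apply: adj_sym. Qed.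

Lemma induced_irr : irreflexive induced_adj.
Proof. by move=> u; apply: adj_irr. Qed.

Definition induced : sgraph := SGraph induced_sym induced_irr.
End Induced.

Definition local_graph (G : sgraph) (x : G) : sgraph := induced (nbrs x).

Definition strongly_regular (G : sgraph) (nu kappa lambda mu : nat) : Prop :=
  [/\ #|G| = nu,
      forall x : G, #|nbrs x| = kappa,
      forall x y : G, adj x y -> #|nbrs x :&: nbrs y| = lambda
    & forall x y : G, x != y -> ~~ adj x y -> #|nbrs x :&: nbrs y| = mu].

Section Eigenvalues.
Import GRing.Theory Num.Theory.
Local Open Scope ring_scope.

Definition adj_mx (R : nzRingType) (G : sgraph) : 'M[R]_#|G| :=
  \matrix_(i, j) (adj (enum_val i) (enum_val j))%:R.

(* Over a real closed field every eigenvalue of a symmetric matrix lies in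
   the field, so no eigenvalue is missed. *)
Definition smallest_eigenvalue (R : rcfType) (G : sgraph) (a : R) : Prop :=
  eigenvalue (adj_mx R G) a /\
  forall b : R, eigenvalue (adj_mx R G) b -> a <= b.
End Eigenvalues.

Definition is_triple (G : sgraph) (x y z : G) : Prop :=
  [/\ adj x y, dist x z = 2 & dist y z = 2].

Definition triple_intersection_number (G : sgraph) (gamma : nat) : Prop :=
  (exists x y z : G, is_triple x y z) /\
  forall x y z : G, is_triple x y z -> #|nbrs x :&: nbrs y :&: nbrs z| = gamma.

Definition orthogonal_array (p q : nat) (A : 'M['I_q]_(p, q ^ 2)) : Prop :=
  forall i j : 'I_p, i != j ->
  forall a b : 'I_q, #|[set c | (A i c == a) && (A j c == b)]| = 1.

Section OABlockGraph.
Variables (p q : nat) (A : 'M['I_q]_(p, q ^ 2)).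

Definition oa_adj : rel 'I_(q ^ 2) :=
  fun c d => (c != d) && [exists i, A i c == A i d].

Lemma oa_adj_sym : symmetric oa_adj.
Proof.
by move=> c d; rewrite /oa_adj eq_sym; under eq_existsb do rewrite eq_sym.
Qed.

Lemma oa_adj_irr : irreflexive oa_adj.
Proof. by move=> c; rewrite /oa_adj eqxx. Qed.

Definition oa_block_graph : sgraph := SGraph oa_adj_sym oa_adj_irr.
End OABlockGraph.

Definition is_oa_block_graph (G : sgraph) : Prop :=
  exists (p q : nat) (A : 'M['I_q]_(p, q ^ 2)),
    orthogonal_array A /\ isomorphic G (oa_block_graph A).

Definition steiner_system (p q : nat) (B : {set {set 'I_q}}) : Prop :=
  (forall b, b \in B -> #|b| = p) /\
  forall x y : 'I_q, x != y -> #|[set b in B | (x \in b) && (y \in b)]| = 1.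

Section SteinerBlockGraph.
Variables (q : nat) (B : {set {set 'I_q}}).

(* b != c only matters for blocks of size 1. *)
Definition steiner_adj : rel {b : {set 'I_q} | b \in B} :=
  fun b c => (b != c) && (#|val b :&: val c| == 1).

Lemma steiner_adj_sym : symmetric steiner_adj.
Proof. by move=> b c; rewrite /steiner_adj eq_sym setIC. Qed.

Lemma steiner_adj_irr : irreflexive steiner_adj.
Proof. by move=> b; rewrite /steiner_adj eqxx. Qed.

Definition steiner_block_graph : sgraph :=
  SGraph steiner_adj_sym steiner_adj_irr.
End SteinerBlockGraph.

Definition is_steiner_block_graph (G : sgraph) : Prop :=
  exists (p q : nat) (B : {set {set 'I_q}}),
    steiner_system p B /\ isomorphic G (steiner_block_graph B).

(* Main.v *)
Require Import Defs.
From HB Require Import structures.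
From mathcomp Require Import all_boot all_order all_algebra.
From mathcomp Require Import zify ring lra.
Import Order.TTheory GRing.Theory Num.Theory.

(** Both kinds of local graph are block graphs of partial geometries: there are
    points, every block (a neighbor of the base vertex x) has K points, every
    point lies on R blocks, two blocks are adjacent exactly when they share a
    point (then only one), and for a point s off a block B exactly al of the
    blocks through s meet B.  An orthogonal array OA(K, q) has R = q and
    al = K - 1, a Steiner system has al = K.  The eigenvalue hypothesis forces
    m = K ([eigenvalue_eq_block_size]), and the bound on the valency says
    R > al + 1.  The two forbidden values of c_2 are the same number K (al + 1),
    which is the number of blocks of a partial geometry with the same K and al
    and with al + 1 blocks on each point: a net of order K, respectively an
    affine plane of order K.  So suppose that c_2 = K (al + 1).

    For x, z at distance 2, let M be the set of their common neighbors, viewed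
    as a set of blocks of the geometry at x.  By the triple condition each block
    outside M meets 0 or gamma blocks of M.  Counting first and second moments
    gives gamma = al + 1, and since D >= 3 some block meets no block of M; it
    follows that every point on a block of M is on exactly al + 1 of them, and
    that a block with two such points is itself in M ([subgeometry]).  Thus M is
    a sub-net or subplane; in particular, disjointness in M behaves like
    parallelism in an affine plane ([parallel_through], [parallel_trans]).

    Next, two disjoint blocks c, d at x determine M ([mu_graph_cover],
    [mu_graph_eq]): the common neighbors of c and d form such a set in the
    geometry at c, in which x has a parallel z, and then c, d lie in M(x, z); if they
    also lie in M(x, z'), then z' is another parallel of x there, and x, z, z'
    have too many common neighbors for M(x, z) and M(x, z') to differ.

    Finally ([no_vertices_at_distance_two]), fix a block c and a point s off c.
    As R > al + 1, two blocks d, d' through s miss c, giving M1 containing c, d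
    and M2 containing c, d'.  The al >= 2 blocks joining s to c are in both.
    Because K >= 3, one of them has a point u that is neither s nor on c; the
    parallel g to c through u in M1 meets all these joining blocks, hence has
    two points in M2, hence is in M2.  So c and g are disjoint blocks of both,
    M1 = M2, and d, d' are two parallels to c through s: a contradiction. *)

Set Implicit Arguments.
Unset Strict Implicit.
Unset Printing Implicit Defensive.
Local Open Scope nat_scope.

(** * Geometries on sets of vertices *)

(** The condition that [pts] makes [N] the block set of a partial geometry whose
    block graph is the graph induced on [N].  Blocks are a subset of the vertices
    of [G], rather than all of them, so that the geometries at different vertices
    of one graph live on the same type. *)
Record geometry (G : sgraph) (N : {set G}) (P : finType) (pts : G -> {set P})
    (K R al : nat) : Prop := Geometry {
  block_size : forall v, v \in N -> #|pts v| = K;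
  block_meet : forall v w, v \in N -> w \in N -> v != w ->
    #|pts v :&: pts w| = adj v w;
  point_degree : forall s, #|[set v in N | s \in pts v]| = R;
  point_block : forall s v, v \in N -> s \notin pts v ->
    #|[set w in N | (s \in pts w) && adj v w]| = al
}.

Lemma card_setIE (T : finType) (A B : {set T}) :
  #|A :&: B| = \sum_(s in A) (s \in B).
Proof.
rewrite -sum1_card big_mkcond [RHS]big_mkcond /=.
by apply: eq_bigr => s _; rewrite inE; case: (s \in A); case: (s \in B).
Qed.

Lemma card_setIdE (T : finType) (A : {set T}) (Q : pred T) :
  #|[set v in A | Q v]| = \sum_(v in A) Q v.
Proof.
rewrite -sum1_card big_mkcond [RHS]big_mkcond /=.
by apply: eq_bigr => s _; rewrite inE; case: (s \in A); case: (Q s).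
Qed.

Lemma mem_setId (T : finType) (A : {set T}) (Q : pred T) v :
  (v \in [set w in A | Q w]) = (v \in A) && Q v.
Proof. by rewrite inE. Qed.

Lemma double_count (T P : finType) (pts : T -> {set P}) (A : {set T})
    (C : {set P}) :
  \sum_(w in A) #|C :&: pts w| = \sum_(s in C) #|[set w in A | s \in pts w]|.
Proof.
under eq_bigr do rewrite card_setIE.
rewrite exchange_big /=; apply: eq_bigr => s _.
by rewrite card_setIdE.
Qed.

Lemma sum_incidence (T P : finType) (pts : T -> {set P}) (A : {set T})
    (F : P -> nat) (H : T -> nat) :
  \sum_(v in A) H v * \sum_(s in pts v) F s
  = \sum_s F s * \sum_(v in [set v in A | s \in pts v]) H v.
Proof.
under eq_bigr do rewrite big_distrr big_mkcond /=.
rewrite exchange_big /=; apply: eq_bigr => s _.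
rewrite big_distrr /= [LHS]big_mkcond [RHS]big_mkcond /=; apply: eq_bigr => v _.
by rewrite inE; case: (v \in A); case: (s \in pts v); rewrite //= mulnC.
Qed.

Section Geometry.
Variables (G : sgraph) (N : {set G}) (P : finType) (pts : G -> {set P}).
Variables (K R al : nat).
Hypothesis geo : geometry N pts K R al.

Lemma block_eq v w s t : v \in N -> w \in N -> s != t ->
  s \in pts v -> t \in pts v -> s \in pts w -> t \in pts w -> v = w.
Proof.
move=> vN wN st sv tv sw tw; apply/eqP; apply: contraT => vw.
have := block_meet geo vN wN vw.
have : 1 < #|pts v :&: pts w|.
  by apply/card_gt1P; exists s, t; rewrite !inE sv tv sw tw st.
by case: (adj v w) => + E; rewrite E.
Qed.

Lemma block_disjoint v w s : v \in N -> w \in N -> v != w -> ~~ adj v w ->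
  s \in pts v -> s \notin pts w.
Proof.
move=> vN wN vw /negbTE nvw sv; apply/negP => sw.
have /eqP := block_meet geo vN wN vw.
by rewrite nvw cards_eq0 => /eqP/setP/(_ s); rewrite !inE sv sw.
Qed.

Lemma adj_point v w : v \in N -> w \in N -> adj v w ->
  exists s, s \in pts v /\ s \in pts w.
Proof.
move=> vN wN vw.
have nvw : v != w by apply: contraTneq vw => ->; rewrite adj_irr.
have := block_meet geo vN wN nvw; rewrite vw => E.
have /card_gt0P[s] : 0 < #|pts v :&: pts w| by rewrite E.
by rewrite inE => /andP[]; exists s.
Qed.

Lemma point_adj v w s : v \in N -> w \in N -> v != w ->
  s \in pts v -> s \in pts w -> adj v w.
Proof.
move=> vN wN vw sv sw; apply: contraT => nvw.
by have := block_disjoint vN wN vw nvw sv; rewrite sw.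
Qed.

Lemma block_meetE v w : v \in N -> w \in N ->
  #|pts v :&: pts w| = K * (v == w) + adj v w.
Proof.
move=> vN wN; case: eqP => [<-|/eqP vw].
  by rewrite setIid (block_size geo vN) adj_irr muln1 addn0.
by rewrite (block_meet geo vN wN vw) muln0.
Qed.

(** The incidence matrix form of the axioms.  It drives both the moment count
    below and the eigenvalue computation: its two cases contain all that is
    needed of the square of the adjacency matrix. *)
Lemma meet_through_point s v : v \in N ->
  \sum_(w in [set w in N | s \in pts w]) #|pts v :&: pts w|
  = if s \in pts v then R - 1 + K else al.
Proof.
move=> vN; case: ifPn => sv.
  have vs : v \in [set w in N | s \in pts w] by rewrite inE vN.
  rewrite (big_setD1 v) //= setIid (block_size geo vN) addnC; congr (_ + _).
  rewrite (eq_bigr (fun=> 1)); last first.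
    move=> w; rewrite !inE => /and3P[wv wN sw].
    by rewrite (block_meet geo) 1?eq_sym // (point_adj _ _ _ sv) 1?eq_sym.
  rewrite sum1_card -(point_degree geo s) (cardsD1 v [set w in _ | _]) vs.
  by rewrite add1n subn1.
rewrite -(point_block geo vN sv).
have -> : [set w in N | (s \in pts w) && adj v w]
        = [set w in [set w in N | s \in pts w] | adj v w].
  by apply/setP => w; rewrite !inE andbA.
rewrite card_setIdE; apply: eq_bigr => w; rewrite inE => /andP[wN sw].
by rewrite (block_meet geo) //; apply: contraNneq sv => ->.
Qed.

(** Each of the K points of c is joined to d by al blocks, and no block is
    counted twice because it would share two points with c. *)
Lemma common_neighbors c d : c \in N -> d \in N -> c != d -> ~~ adj c d ->
  #|N :&: nbrs c :&: nbrs d| = K * al.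
Proof.
move=> cN dN cd ncd.
have -> : N :&: nbrs c :&: nbrs d = [set w in N :&: nbrs d | adj c w].
  by apply/setP => w; rewrite !inE andbAC.
rewrite card_setIdE -(block_size geo cN) -sum_nat_const.
rewrite (eq_bigr (fun w => #|pts c :&: pts w|)); last first.
  move=> w; rewrite !inE => /andP[wN dw]; rewrite (block_meet geo) //.
  by apply: contraNneq ncd => ->; rewrite adj_sym.
rewrite double_count; apply: eq_bigr => s sc.
rewrite -(point_block geo dN (block_disjoint cN dN cd ncd sc)).
by apply: eq_card => w; rewrite !inE; case: (w \in N); rewrite //= andbC.
Qed.

End Geometry.

(** * The common neighbors of two vertices at distance two *)

Definition mu_graph (G : sgraph) (x z : G) : {set G} := nbrs x :&: nbrs z.

Definition at_distance_two (G : sgraph) (x z : G) : bool :=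
  [&& x != z, ~~ adj x z & mu_graph x z != set0].

Section MuGraph.
Variables (G : sgraph) (K al gam : nat).
Hypothesis K_ge3 : 2 < K.
Hypothesis K_le : K <= al.+1.
Hypothesis card_mu : forall x z : G,
  at_distance_two x z -> #|mu_graph x z| = K * al.+1.
Hypothesis triple_card : forall x y z : G,
  adj x y -> at_distance_two x z -> at_distance_two y z ->
  #|nbrs x :&: nbrs y :&: nbrs z| = gam.
Hypothesis far_neighbor : forall x z : G, at_distance_two x z ->
  exists y : G, [/\ adj x y, ~~ adj y z & mu_graph y z = set0].
Hypothesis local_geometry : forall x : G,
  exists (P : finType) (pts : G -> {set P}) (R : nat),
    geometry (nbrs x) pts K R al /\ al.+1 < R.

Lemma at_distance_two_sym (x z : G) : at_distance_two x z = at_distance_two z x.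
Proof. by rewrite /at_distance_two eq_sym adj_sym /mu_graph setIC. Qed.

(** Seen from w, the vertices x and z are disjoint blocks of the geometry
    at w. *)
Lemma mu_graph_valency (x z w : G) : at_distance_two x z ->
  w \in mu_graph x z -> #|mu_graph x z :&: nbrs w| = K * al.
Proof.
case/and3P => xz nxz _; rewrite !inE => /andP[xw zw].
have [P [pts [R [geo _]]]] := local_geometry w.
have wxN : x \in nbrs w by rewrite inE adj_sym.
have wzN : z \in nbrs w by rewrite inE adj_sym.
rewrite -(common_neighbors geo wxN wzN xz nxz).
by rewrite [mu_graph x z :&: _]setIC /mu_graph setIA.
Qed.

Section Fixed.
Variables (x z : G) (xz : at_distance_two x z).
Variables (P : finType) (pts : G -> {set P}) (R : nat).
Hypothesis geo : geometry (nbrs x) pts K R al.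
Hypothesis R_gt : al.+1 < R.

Local Notation N := (nbrs x).
Local Notation M := (mu_graph x z).

Let n s := #|[set v in M | s \in pts v]|.
Let f v := \sum_(s in pts v) n s.

Let MN v : v \in M -> v \in N. Proof. by rewrite inE => /andP[]. Qed.

(** [f] is A + K I, for A the adjacency matrix of the local graph, applied to
    the indicator of M, since A + K I is the product of the incidence matrix and
    its transpose.  This is the function whose moments are computed. *)
Let fE v : v \in N -> f v = K * (v \in M) + #|M :&: nbrs v|.
Proof.
move=> vN; rewrite /f /n -double_count.
rewrite (eq_bigr (fun w => K * (v == w) + adj v w)); last first.
  by move=> w /MN wN; rewrite (block_meetE geo).
rewrite big_split /= -big_distrr /=; congr (K * _ + _).
  case: (boolP (v \in M)) => vM.
    by rewrite (big_setD1 v) //= eqxx big1 // => w; rewrite !inE eq_sym => /andP[/negbTE->].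
  by rewrite big1 // => w wM; case: eqP => // E; rewrite E wM in vM.
by rewrite card_setIE; apply: eq_bigr => w _; rewrite inE.
Qed.

Let f_in v : v \in M -> f v = K * al.+1.
Proof.
move=> vM; rewrite fE ?MN // vM (mu_graph_valency xz vM).
by rewrite muln1 mulnS.
Qed.

Let f_out v : v \in N -> v \notin M -> f v = 0 \/ f v = gam.
Proof.
move=> vN vM; rewrite fE // (negbTE vM) muln0 add0n.
have [->|ne] := eqVneq (M :&: nbrs v) set0; first by left; rewrite cards0.
have [x_z nxz _] := and3P xz.
move: (vN); rewrite inE => xv.
have nzv : ~~ adj z v by move: vM; rewrite !inE xv.
right; rewrite -(triple_card xv xz).
  by rewrite /mu_graph setIAC.
apply/and3P; split; last 1 first.
- case/set0Pn: ne => w; rewrite !inE => /andP[/andP[_ zw] vw].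
  by apply/set0Pn; exists w; rewrite !inE zw vw.
- by apply: contraTneq xv => ->.
- by rewrite adj_sym.
Qed.

Let sum_n : \sum_s n s = #|M| * K.
Proof.
transitivity (\sum_(s in [set: P]) n s); first by apply: eq_bigl => s; rewrite inE.
rewrite /n -double_count -sum_nat_const; apply: eq_bigr => w /MN wN.
by rewrite setTI (block_size geo).
Qed.

Let sum_n2 : \sum_s n s * n s = #|M| * #|M|.
Proof.
have := sum_incidence pts M n (fun=> 1).
under [in RHS]eq_bigr do rewrite sum1_card -/(n _).
move=> <-; rewrite -[RHS]sum_nat_const; apply: eq_bigr => w wM.
by rewrite mul1n -/(f w) f_in // card_mu.
Qed.

Let sum_f : \sum_(v in N) f v = #|M| * (K * R).
Proof.
have := sum_incidence pts N n (fun=> 1).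
under eq_bigr do rewrite mul1n -/(f _).
move=> ->.
under eq_bigr do rewrite sum1_card (point_degree geo).
by rewrite -big_distrl /= sum_n mulnA.
Qed.

Let f_through_point s :
  \sum_(v in [set v in N | s \in pts v]) f v = al * #|M| + (R - 1 + K - al) * n s.
Proof.
rewrite /f /n.
under eq_bigr do rewrite -double_count.
rewrite exchange_big /=.
rewrite (eq_bigr (fun w => al + (R - 1 + K - al) * (s \in pts w))); last first.
  move=> w wM.
  under eq_bigr do rewrite setIC.
  by rewrite (meet_through_point geo) ?MN //; case: (s \in pts w); lia.
by rewrite big_split /= sum_nat_const mulnC -big_distrr /= card_setIdE.
Qed.

Let sum_f2 : \sum_(v in N) f v * f v
  = al * #|M| * (#|M| * K) + (R - 1 + K - al) * (#|M| * #|M|).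
Proof.
rewrite {2}/f sum_incidence.
under eq_bigr do rewrite f_through_point mulnDr.
rewrite big_split /= -big_distrl /= sum_n mulnC; congr (_ + _).
by under eq_bigr do rewrite mulnCA; rewrite -big_distrr /= sum_n2.
Qed.

(** Off M, [f] is 0 or gam, so its second moment there is gam times its first.
    With c = K (al + 1) the size of M, the first moment off M is
    c K (R - al - 1) and the second is c^2 (R - al - 1), whence gam K = c;
    the strict bound on R is what allows the division. *)
Let gam_eq : gam = al.+1.
Proof.
have MsN : M \subset N by apply/subsetP => v /MN.
have split F : \sum_(v in N) F v = \sum_(v in M) F v + \sum_(v in N :\: M) F v :> nat.
  by rewrite (big_setID M) /= (setIidPr MsN).
have in1 : \sum_(v in M) f v = #|M| * #|M|.
  by rewrite -sum_nat_const; apply: eq_bigr => v /f_in ->; rewrite card_mu.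
have in2 : \sum_(v in M) f v * f v = #|M| * (#|M| * #|M|).
  by rewrite -[RHS]sum_nat_const; apply: eq_bigr => v /f_in ->; rewrite card_mu.
have out : \sum_(v in N :\: M) f v * f v = gam * \sum_(v in N :\: M) f v.
  rewrite big_distrr /=; apply: eq_bigr => v; rewrite inE => /andP[vM vN].
  by case: (f_out vN vM) => ->; rewrite ?muln0.
move: sum_f sum_f2; rewrite !split in1 in2 out.
set T := \sum_(v in _) _; rewrite (card_mu xz).
(* Removes the truncated subtractions. *)
have [r ->] : exists r, R = r + al.+2 by exists (R - al.+2); lia.
move=> E1 E2.
have K0 : 0 < K by lia.
have {}E1 : T = K * al.+1 * (K * r.+1).
  by apply: (@addnI (K * al.+1 * (K * al.+1))); rewrite E1; nia.
have {}E2 : gam * T = K * al.+1 * (K * al.+1) * r.+1.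
  apply: (@addnI (K * al.+1 * (K * al.+1 * (K * al.+1)))); rewrite E2.
  have -> : r + al.+2 - 1 + K - al = r + K + 1 by lia.
  by nia.
have : (K * al.+1 * (K * r.+1)) * gam = (K * al.+1 * (K * r.+1)) * al.+1.
  by rewrite -E1 mulnC E2 E1; nia.
move/eqP; rewrite eqn_pmul2l; first by move/eqP.
by rewrite !muln_gt0 K0.
Qed.

Let n_le_f v s : s \in pts v -> n s <= f v.
Proof. by move=> sv; rewrite /f (bigD1 s) //= leq_addr. Qed.

(** If s were on more than al + 1 blocks of M, then every block through s
    would be in M, and so every block would meet one of them: those containing s
    trivially, the others because al > 0.  But the block y given by a vertex at
    distance 3 from z meets none. *)
Let n_le s : n s <= al.+1.
Proof.
rewrite leqNgt; apply/negP => ns.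
have full v : v \in N -> s \in pts v -> v \in M.
  move=> vN sv; apply: contraT => vM; have := n_le_f sv.
  by case: (f_out vN vM) => ->; rewrite ?gam_eq; lia.
have [y [xy nyz yz0]] := far_neighbor xz.
have yN : y \in N by rewrite inE.
have yM : y \notin M by rewrite !inE xy adj_sym.
have fy : f y = 0.
  rewrite fE // (negbTE yM) muln0 add0n; apply/eqP; rewrite cards_eq0.
  by rewrite /mu_graph -setIA [nbrs z :&: _]setIC -/(mu_graph y z) yz0 setI0.
have sy : s \notin pts y by apply/negP => /n_le_f; rewrite fy; lia.
have /card_gt0P[w] : 0 < #|[set w in N | (s \in pts w) && adj y w]|.
  by rewrite (point_block geo yN sy); lia.
rewrite inE => /and3P[wN sw yw].
have := full w wN sw; rewrite inE => /andP[_ zw].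
by have := in_set0 w; rewrite -yz0 !inE yw -[adj z w]in_set zw.
Qed.

(** [S] is the set of points covered by M.  On a block of M the numbers [n s]
    are at most al + 1 and sum to K (al + 1), so they are all equal to
    al + 1; a block with two points in [S] has [f] at least 2 (al + 1), too
    much for a block outside M. *)
Lemma subgeometry : exists S : {set P},
  [/\ forall v, v \in M -> pts v \subset S,
      forall v s t, v \in N -> s != t -> s \in pts v -> t \in pts v ->
        s \in S -> t \in S -> v \in M
    & forall s, s \in S -> #|[set v in M | s \in pts v]| = al.+1].
Proof.
have nM v s : v \in M -> s \in pts v -> n s = al.+1.
  move=> vM sv; apply/eqP; rewrite eqn_leq n_le /= leqNgt; apply/negP => lt.
  have := f_in vM; rewrite /f (bigD1 s) //=.
  have : \sum_(i in pts v | i != s) n i <= \sum_(i in pts v | i != s) al.+1.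
    by apply: leq_sum => i _; apply: n_le.
  have : \sum_(i in pts v) al.+1 = K * al.+1.
    by rewrite sum_nat_const (block_size geo) ?MN.
  by rewrite (bigD1 s) //=; lia.
have nS s : s \in [set s | 0 < n s] -> n s = al.+1.
  by rewrite inE => /card_gt0P[v]; rewrite inE => /andP[]; apply: nM.
exists [set s | 0 < n s]; split => //.
  by move=> v vM; apply/subsetP => s sv; rewrite inE (nM v).
move=> v s t vN st sv tv sS tS; apply: contraT => vM.
have : n s + n t <= f v.
  by rewrite /f (bigD1 s) //= (bigD1 t) /= ?tv 1?eq_sym //= addnA leq_addr.
by rewrite !nS //; case: (f_out vN vM) => ->; rewrite ?gam_eq; lia.
Qed.

Section Parallel.
Variable S : {set P}.
Hypothesis blocks_in : forall v, v \in M -> pts v \subset S.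
Hypothesis block_of_two : forall v s t, v \in N -> s != t ->
  s \in pts v -> t \in pts v -> s \in S -> t \in S -> v \in M.
Hypothesis degree_in : forall s, s \in S ->
  #|[set v in M | s \in pts v]| = al.+1.

(** The al blocks joining s to v have two points in [S], so they are in M; of the
    al + 1 blocks of M through s this leaves one. *)
Lemma parallel_through s v : v \in M -> s \in S -> s \notin pts v ->
  exists2 w, [set u in M | (s \in pts u) && ~~ adj v u] = [set w] & w != v.
Proof.
move=> vM sS sv.
have vN := MN vM.
have meeting : [set u in N | (s \in pts u) && adj v u]
    = [set u in [set u in M | s \in pts u] | adj v u].
  apply/setP => u; rewrite 3!mem_setId.
  apply/idP/idP; last first.
    by case/andP=> /andP[uM su] vu; rewrite (MN uM) su.
  case/and3P => uN su vu; rewrite su vu !andbT.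
  have [t [tv tu]] := adj_point geo vN uN vu.
  apply: (block_of_two uN _ su tu sS (subsetP (blocks_in vM) t tv)).
  by apply: contraNneq sv => ->.
have := degree_in sS.
have := point_block geo vN sv; rewrite meeting => E1 E2.
have : #|[set u in M | (s \in pts u) && ~~ adj v u]| = 1.
  have := cardsID [set u | adj v u] [set u in M | s \in pts u].
  rewrite E2 -setIdE E1.
  have -> : [set u in M | s \in pts u] :\: [set u | adj v u]
      = [set u in M | (s \in pts u) && ~~ adj v u].
    by apply/setP => u; rewrite in_setD !mem_setId in_set andbC andbA.
  by lia.
case/eqP/cards1P => w Ew; exists w => //.
have : w \in [set w] by rewrite inE.
by rewrite -Ew mem_setId => /and3P[_ sw _]; apply: contraNneq sv => <-.
Qed.

End Parallel.

(** Two blocks parallel to u that shared a point would contradict the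
    uniqueness of the parallel to u through it. *)
Lemma parallel_trans u v w : u \in M -> v \in M -> w \in M ->
  u != v -> ~~ adj u v -> u != w -> ~~ adj u w -> v != w -> ~~ adj v w.
Proof.
move=> uM vM wM uv nuv uw nuw vw; apply/negP => avw.
have [S [blocks_in two deg]] := subgeometry.
have [s [sv sw]] := adj_point geo (MN vM) (MN wM) avw.
have su : s \notin pts u.
  by apply: (block_disjoint geo (MN vM) (MN uM)) sv; rewrite 1?eq_sym // adj_sym.
have sS : s \in S := subsetP (blocks_in v vM) s sv.
have [t Et _] := parallel_through blocks_in two deg uM sS su.
have vt : v \in [set t] by rewrite -Et mem_setId vM sv nuv.
have wt : w \in [set t] by rewrite -Et mem_setId wM sw nuw.
by move: vt wt vw; rewrite !inE => /eqP-> /eqP->; rewrite eqxx.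
Qed.

End Fixed.

Lemma mem_mu_graph (x z y : G) : (y \in mu_graph x z) = adj x y && adj z y.
Proof. by rewrite !inE. Qed.

Lemma at_distance_two_of (x z y : G) : x != z -> ~~ adj x z ->
  adj x y -> adj z y -> at_distance_two x z.
Proof.
move=> xz nxz xy zy; apply/and3P; split=> //.
by apply/set0Pn; exists y; rewrite mem_mu_graph xy zy.
Qed.

(** Of the K (al + 1) common neighbors of c and d, the vertex x is adjacent to
    K al; the K others include x itself and, as K > 1, some z. *)
Lemma mu_graph_cover (x c d : G) :
  adj x c -> adj x d -> c != d -> ~~ adj c d ->
  exists z, [/\ at_distance_two x z, c \in mu_graph x z & d \in mu_graph x z].
Proof.
move=> xc xd cd ncd.
have cd2 : at_distance_two c d.
  by apply: (at_distance_two_of (y := x)) => //; rewrite adj_sym.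
have xM : x \in mu_graph c d by rewrite mem_mu_graph !(adj_sym _ x) xc xd.
have : 1 < #|mu_graph c d :\: nbrs x|.
  have := cardsID (nbrs x) (mu_graph c d).
  by rewrite (card_mu cd2) (mu_graph_valency cd2 xM) mulnS; lia.
rewrite (cardsD1 x) inE [x \in nbrs x]inE adj_irr xM ltnS => /card_gt0P[z].
rewrite !inE => /and3P[zx nxz /andP[cz dz]].
exists z; rewrite !mem_mu_graph xc xd !(adj_sym z) cz dz; split=> //.
apply: (at_distance_two_of (y := c)); rewrite 1?eq_sym //.
by rewrite adj_sym.
Qed.

(** In the geometry at c, the vertices x, z, z' are mutually parallel blocks of
    the set attached to c and d, so a neighbor of x in that set is also adjacent
    to z and z'.  Together with c this gives more than K al blocks in both sets;
    but a point covered by one and not by the other would leave at most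
    (K - 1) (al + 1) <= K al blocks in common. *)
Lemma mu_graph_eq (x z z' c d : G) :
  at_distance_two x z -> at_distance_two x z' -> c != d -> ~~ adj c d ->
  c \in mu_graph x z -> d \in mu_graph x z ->
  c \in mu_graph x z' -> d \in mu_graph x z' ->
  mu_graph x z = mu_graph x z'.
Proof.
move=> xz xz' cd ncd cM dM cM' dM'.
have [->//|zz'] := eqVneq z z'.
move: (cM) (dM) (cM') (dM'); rewrite !mem_mu_graph.
move=> /andP[xc zc] /andP[xd zd] /andP[_ z'c] /andP[_ z'd].
have cd2 : at_distance_two c d.
  by apply: (at_distance_two_of (y := x)) => //; rewrite adj_sym.
have xN : x \in mu_graph c d by rewrite mem_mu_graph !(adj_sym _ x) xc xd.
have zN : z \in mu_graph c d by rewrite mem_mu_graph !(adj_sym _ z) zc zd.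
have z'N : z' \in mu_graph c d by rewrite mem_mu_graph !(adj_sym _ z') z'c z'd.
have [/negbTE x_z nxz _] := and3P xz; have [/negbTE x_z' nxz' _] := and3P xz'.
have [Pc [ptsc [Rc [geoc Rc_gt]]]] := local_geometry c.
have shared y t : t \in mu_graph c d -> x != t -> ~~ adj x t ->
    y \in mu_graph c d -> adj x y -> adj t y.
  move=> tN xt nxt yN xy; apply: contraT => nty.
  have yt : t != y by apply: contraNneq nxt => ->.
  have xy' : x != y by apply: contraTneq xy => ->; rewrite adj_irr.
  rewrite eq_sym in xt; rewrite adj_sym in nxt.
  by have := parallel_trans cd2 geoc Rc_gt tN xN yN xt nxt yt nty xy'; rewrite xy.
have large : K * al < #|mu_graph x z :&: mu_graph x z'|.
  rewrite -(mu_graph_valency cd2 xN).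
  have <- : #|c |: (mu_graph c d :&: nbrs x)| = (#|mu_graph c d :&: nbrs x|).+1.
    by rewrite cardsU1 !inE adj_irr.
  apply/subset_leq_card/subsetP => y; rewrite in_setU1 => /predU1P[->|].
    by rewrite inE cM cM'.
  rewrite inE [y \in nbrs x]inE => /andP[yN xy].
  by rewrite inE !mem_mu_graph xy (shared y z) ?(shared y z') //= ?x_z ?x_z'.
have [P [pts [R [geo R_gt]]]] := local_geometry x.
have [S [inS twoS degS]] := subgeometry xz geo R_gt.
have [S' [inS' twoS' degS']] := subgeometry xz' geo R_gt.
have SS' : S \subset S'.
  apply/subsetP => s sS; apply: contraT => sS'; move: large; rewrite ltnNge.
  have le : K * al.+1 - al.+1 <= K * al by rewrite mulnS leq_subLR leq_add2r.
  case/negP; apply: leq_trans le.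
  rewrite -(card_mu xz) -(degS s sS).
  have sub : [set v in mu_graph x z | s \in pts v] \subset mu_graph x z.
    by apply/subsetP => v; rewrite mem_setId => /andP[].
  rewrite -(setIidPr sub) -cardsD; apply/subset_leq_card/subsetP => v.
  rewrite in_setI in_setD mem_setId => /andP[vM vM'].
  rewrite vM /= andbT; apply: contra sS' => sv.
  exact: subsetP (inS' v vM') s sv.
apply/eqP; rewrite eqEcard (card_mu xz) (card_mu xz') leqnn andbT.
apply/subsetP => v vM.
have vN : v \in nbrs x by move: vM; rewrite inE => /andP[].
have : 1 < #|pts v| by rewrite (block_size geo vN); apply: ltnW.
case/card_gt1P => s [t [sv tv st]].
have vS' := subset_trans (inS v vM) SS'.
by apply: (twoS' v s t); rewrite // (subsetP vS').
Qed.

Lemma no_vertices_at_distance_two (x z : G) : at_distance_two x z -> False.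
Proof.
move=> xz.
have al_gt1 : 1 < al by lia.
have [P [pts [R [geo R_gt]]]] := local_geometry x.
have MN v z' : v \in mu_graph x z' -> v \in nbrs x by rewrite inE => /andP[].
have : 1 < #|mu_graph x z| by rewrite (card_mu xz) mulnS; lia.
case/card_gt1P => c0 [c [/MN c0N /MN cN c0c]].
have [s sc0 sc] : exists2 s, s \in pts c0 & s \notin pts c.
  apply/subsetPn; apply: contra c0c => sub; apply: contraTT K_ge3 => c0c.
  have := block_meet geo c0N cN c0c; rewrite (setIidPl sub) (block_size geo c0N).
  by move->; case: adj.
(* Of the R blocks through s, al meet c; two of the others are d and d'. *)
pose through := [set w in nbrs x | s \in pts w].
have Ethrough : #|[set w in through | adj c w]| = al.
  rewrite -(point_block geo cN sc); apply: eq_card => w.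
  by rewrite !mem_setId andbA.
have : 1 < #|[set w in through | ~~ adj c w]|.
  have := cardsID [set w | adj c w] through.
  rewrite (point_degree geo) -setIdE Ethrough.
  have -> : through :\: [set w | adj c w] = [set w in through | ~~ adj c w].
    by apply/setP => w; rewrite in_setD mem_setId in_set andbC.
  by lia.
case/card_gt1P => d [d' []].
rewrite !mem_setId => /andP[/andP[dN sd] ncd] /andP[/andP[d'N sd'] ncd'] dd'.
have cNx : adj x c by move: cN; rewrite inE.
have ne_c w : s \in pts w -> c != w by apply: contraTneq => <-.
have cover w : w \in nbrs x -> s \in pts w -> ~~ adj c w ->
    exists z, [/\ at_distance_two x z, c \in mu_graph x z & w \in mu_graph x z].
  by rewrite inE => xw sw ncw; apply: mu_graph_cover; rewrite ?ne_c.
have [z1 [xz1 cM1 dM1]] := cover d dN sd ncd.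
have [z2 [xz2 cM2 d'M2]] := cover d' d'N sd' ncd'.
have [S1 [inS1 twoS1 degS1]] := subgeometry xz1 geo R_gt.
have [S2 [inS2 twoS2 degS2]] := subgeometry xz2 geo R_gt.
have sS1 : s \in S1 := subsetP (inS1 d dM1) s sd.
have sS2 : s \in S2 := subsetP (inS2 d' d'M2) s sd'.
have meets e : e \in nbrs x -> s \in pts e -> adj c e ->
    e \in mu_graph x z1 /\ e \in mu_graph x z2.
  move=> eN se ce.
  have [t [tc te]] := adj_point geo cN eN ce.
  have st : s != t by apply: contraTneq tc => <-.
  split; first by apply: (twoS1 e s t) => //; apply: subsetP (inS1 c cM1) t tc.
  by apply: (twoS2 e s t) => //; apply: subsetP (inS2 c cM2) t tc.
(* The blocks joining s to c belong to both sets; e and e' are two of them. *)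
have : 1 < #|[set w in through | adj c w]| by rewrite Ethrough.
case/card_gt1P => e [e' []].
rewrite !mem_setId => /andP[/andP[eN se] ce] /andP[/andP[e'N se'] ce'] ee'.
have [eM1 eM2] := meets e eN se ce; have [e'M1 e'M2] := meets e' e'N se' ce'.
(* The block e has at least three points: s, the one on c, and u. *)
have [u [ue uc us]] : exists u, [/\ u \in pts e, u \notin pts c & u != s].
  have /card_gt0P[u] : 0 < #|(pts e :\: pts c) :\ s|.
    have := cardsID (pts c) (pts e).
    have -> : #|pts e :&: pts c| = 1.
      by rewrite (block_meet geo eN cN) 1?adj_sym ?ce // eq_sym ne_c.
    rewrite (block_size geo eN) (cardsD1 s (pts e :\: pts c)) in_setD se sc /=.
    by move: K_ge3; clear; lia.
  by rewrite in_setD1 in_setD => /and3P[]; exists u.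
have uS1 : u \in S1 := subsetP (inS1 e eM1) u ue.
have uS2 : u \in S2 := subsetP (inS2 e eM2) u ue.
have [g Eg gc] := parallel_through xz1 geo R_gt inS1 twoS1 degS1 cM1 uS1 uc.
have : g \in [set g] by rewrite inE.
rewrite -Eg mem_setId => /and3P[gM1 ug ncg] {Eg}.
have gN := MN g z1 gM1.
have parallel1 w : w \in mu_graph x z1 -> s \in pts w -> ~~ adj c w -> w = d.
  move=> wM sw ncw.
  have [t Et _] := parallel_through xz1 geo R_gt inS1 twoS1 degS1 cM1 sS1 sc.
  have dt : d \in [set t] by rewrite -Et mem_setId dM1 sd ncd.
  have wt : w \in [set t] by rewrite -Et mem_setId wM sw ncw.
  by move: dt wt; rewrite !inE => /eqP-> /eqP->.
(* Otherwise g would be the parallel d to c through s, and d would share both s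
   and u with e. *)
have sg : s \notin pts g.
  apply/negP => sg; have Egd := parallel1 g gM1 sg ncg; rewrite Egd in ug.
  by move: ncd; rewrite -(block_eq geo eN dN us ue se ug sd) ce.
have meets_g w : w \in mu_graph x z1 -> s \in pts w -> adj c w -> adj g w.
  move=> wM sw cw; apply: contraT => ngw.
  have gw : g != w by apply: contraNneq sg => ->.
  rewrite adj_sym in ncg.
  have := parallel_trans xz1 geo R_gt gM1 cM1 wM gc ncg gw ngw (ne_c w sw).
  by rewrite cw.
have [t [tg te]] := adj_point geo gN eN (meets_g e eM1 se ce).
have [t' [tg' te']] := adj_point geo gN e'N (meets_g e' e'M1 se' ce').
have tt' : t != t'.
  apply: contra ee' => /eqP E; apply/eqP.
  have ts : t' != s by apply: contraNneq sg => <-.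
  by rewrite E in te; apply: (block_eq geo eN e'N ts).
(* Its points t and t' on e and e' are covered by the second set. *)
have gM2 : g \in mu_graph x z2.
  apply: (twoS2 g t t') => //; first exact: subsetP (inS2 e eM2) t te.
  exact: subsetP (inS2 e' e'M2) t' te'.
have EM : mu_graph x z1 = mu_graph x z2.
  by apply: (mu_graph_eq xz1 xz2 (c := c) (d := g)) => //; rewrite eq_sym.
by move: dd'; rewrite (parallel1 d') ?eqxx // EM.
Qed.

End MuGraph.

(** * Distances *)

Section DistanceTheory.
Variable G : sgraph.
Implicit Types x y z : G.

Lemma walkP n x y :
  reflect (exists p : seq G, [/\ size p = n, path (@adj G) x p & last x p = y])
          (walk n x y).
Proof.
apply: (iffP existsP) => [[p /andP[xp /eqP]]|[p [sp xp py]]].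
  by exists p; rewrite size_tuple.
have sp' : size p == n by apply/eqP.
by exists (Tuple sp'); rewrite /= xp py eqxx.
Qed.

Lemma dist_le n x y : walk n x y -> dist x y <= n.
Proof.
move=> w; have [lt|le] := ltnP n #|G|; last first.
  by apply: leq_trans le; rewrite /dist -[leqRHS](size_iota 0) find_size.
rewrite leqNgt; apply/negP => /(before_find 0).
by rewrite nth_iota // add0n w.
Qed.

Hypothesis G_connected : connected G.

Lemma walk_dist x y : walk (dist x y) x y.
Proof.
have : has (fun n => walk n x y) (iota 0 #|G|).
  have /connectP[p xp ->] := G_connected x y.
  case: (shortenP xp) => p' xp' up' _.
  apply/hasP; exists (size p'); last by apply/walkP; exists p'.
  by rewrite mem_iota add0n; have := card_uniqP up' => /= <-; apply: max_card.
move=> h; have := nth_find 0 h; rewrite nth_iota //.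
by rewrite -[X in _ < X](size_iota 0) -has_find.
Qed.

Lemma dist_pred x y n : dist x y = n.+1 ->
  exists2 y', adj y' y & dist x y' = n.
Proof.
move=> E; have := walk_dist x y; rewrite E => /walkP[p []].
case/lastP: p => // p t; rewrite size_rcons rcons_path last_rcons => -[sp].
case/andP=> xp lt ty; subst t.
exists (last x p) => //; apply/eqP; rewrite eqn_leq dist_le /=; last first.
  by apply/walkP; exists p.
have /walkP[r [sr xr ry]] := walk_dist x (last x p).
rewrite -ltnS -E -sr -(size_rcons r y); apply: dist_le.
by apply/walkP; exists (rcons r y); rewrite size_rcons rcons_path last_rcons ry xr.
Qed.

Lemma walk0 x y : walk 0 x y = (x == y).
Proof.
apply/walkP/eqP => [[[|t p] [//=]]|<-]; last by exists [::].
Qed.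

Lemma walk1 x y : walk 1 x y = adj x y.
Proof.
apply/walkP/idP => [[[|t [|u p]] [//= _ /andP[xt _] <-]]|xy] //.
by exists [:: y]; rewrite /= xy.
Qed.

Lemma walk2P x y : reflect (exists t, adj x t /\ adj t y) (walk 2 x y).
Proof.
apply: (iffP (walkP 2 x y)) => [[[|t [|u [|w p]]] [//= _]]|[t [xt ty]]].
  by case/and3P => xt tu _ <-; exists t.
by exists [:: t; y]; rewrite /= xt ty.
Qed.

Lemma dist_xx x : dist x x = 0.
Proof. by apply/eqP; rewrite -leqn0 dist_le // walk0. Qed.

Lemma dist2E x y : (dist x y == 2) = at_distance_two x y.
Proof.
apply/eqP/and3P => [E|[xy nxy /set0Pn[t]]].
  split; first by apply: contra_eq_neq E => ->; rewrite dist_xx.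
    by apply/negP; rewrite -walk1 => /dist_le; rewrite E.
  have := walk_dist x y; rewrite E => /walk2P[t [xt ty]].
  by apply/set0Pn; exists t; rewrite !inE xt adj_sym.
rewrite !inE => /andP[xt yt].
have : dist x y <= 2 by apply: dist_le; apply/walk2P; exists t; rewrite adj_sym in yt.
have := walk_dist x y; case: dist => [|[|[|]]] //; rewrite ?walk0 ?walk1.
  by rewrite (negbTE xy).
by rewrite (negbTE nxy).
Qed.

Lemma dist3_far x y : dist x y = 3 -> ~~ adj y x /\ mu_graph y x = set0.
Proof.
move=> E; split.
  by apply/negP; rewrite adj_sym -walk1 => /dist_le; rewrite E.
apply: contra_eq E => /set0Pn[t]; rewrite !inE => /andP[yt xt].
rewrite neq_ltn ltnS dist_le //; apply/walk2P; exists t.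
by rewrite adj_sym in yt.
Qed.

Lemma exists_dist3 : 3 <= diameter G -> exists x y, dist x y = 3.
Proof.
move=> D3; have /existsP[x /existsP[y xy]] : [exists x : G, exists y : G, 3 <= dist x y].
  move: D3; apply: contraLR => /existsPn no.
  rewrite -ltnNge ltnS; apply/bigmax_leqP => x _; apply/bigmax_leqP => y _.
  by have /existsPn/(_ y) := no x; rewrite -ltnNge ltnS.
have [n E] : exists n, dist x y = n.+3 by exists (dist x y - 3); lia.
exists x; elim: n y E {xy} => [|n IHn] y E; first by exists y.
by have [y' _ E'] := dist_pred E; apply: (IHn y').
Qed.

End DistanceTheory.

(** The value p^2_{1,3} is positive as it counts the last vertex of a geodesic of
    length 3, so from any z at distance 2 from x some neighbor of x is at
    distance 3. *)
Lemma distance_regular_not_locally_geometric (G : sgraph)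
    (p : nat -> nat -> nat -> nat) (K al : nat) :
  distance_regular G p -> 3 <= diameter G ->
  (exists gam, triple_intersection_number G gam) ->
  2 < K -> K <= al.+1 -> inter_c p 2 = K * al.+1 ->
  (forall x : G, exists (P : finType) (pts : G -> {set P}) (R : nat),
    geometry (nbrs x) pts K R al /\ al.+1 < R) ->
  False.
Proof.
move=> [conn dr] D3 [gam [[x [y [z [xy xz yz]]]] triple]] K3 Kle c2 geo.
have d2 (u v : G) : at_distance_two u v -> dist u v = 2.
  by rewrite -(dist2E conn) => /eqP.
have xz2 : at_distance_two x z by rewrite -(dist2E conn) xz.
apply: (no_vertices_at_distance_two K3 Kle _ (gam := gam) _ _ geo xz2).
- move=> u v /d2 uv; rewrite -c2 /inter_c /mu_graph -!sphere1.
  by apply: dr uv; lia.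
- by move=> u v w uv /d2 uw /d2 vw; apply: triple.
move=> u v uv; have [a [b ab]] := exists_dist3 conn D3.
have [b' b'b ab'] := dist_pred conn ab.
have b'a : at_distance_two b' a by rewrite at_distance_two_sym -(dist2E conn) ab'.
have : 0 < p 2 1 3.
  rewrite -(dr 2 1 3 _ _ _ b' a (d2 _ _ b'a)); [|lia..].
  by apply/card_gt0P; exists b; rewrite in_setI sphere1 !inE b'b ab.
rewrite -(dr 2 1 3 _ _ _ u v (d2 _ _ uv)); [|lia..].
case/card_gt0P => t; rewrite in_setI sphere1 !inE => /andP[ut /eqP vt].
by exists t; have [] := dist3_far vt.
Qed.

(** * Orthogonal arrays and Steiner systems as geometries *)

(** Reduces the last axiom of a geometry to counting the blocks on two given
    points. *)
Lemma card_point_block (G : sgraph) (N : {set G}) (P : finType)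
    (pts : G -> {set P}) s v :
  (forall w, w \in N -> v != w -> #|pts v :&: pts w| = adj v w) ->
  s \notin pts v ->
  #|[set w in N | (s \in pts w) && adj v w]|
  = \sum_(t in pts v) #|[set w in N | (s \in pts w) && (t \in pts w)]|.
Proof.
move=> meet sv.
have -> : [set w in N | (s \in pts w) && adj v w]
        = [set w in [set w in N | s \in pts w] | adj v w].
  by apply/setP => w; rewrite !mem_setId andbA.
rewrite card_setIdE (eq_bigr (fun w => #|pts v :&: pts w|)); last first.
  move=> w; rewrite mem_setId => /andP[wN sw].
  by rewrite meet //; apply: contraNneq sv => ->.
rewrite double_count; apply: eq_bigr => t _.
by apply: eq_card => w; rewrite !mem_setId andbA.
Qed.

Lemma geometry_iso (G H : sgraph) (P : finType) (pts : H -> {set P}) K R al :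
  isomorphic G H -> geometry [set: H] pts K R al ->
  exists pts' : G -> {set P}, geometry [set: G] pts' K R al.
Proof.
move=> [f [bij_f adj_f]] geo; exists (pts \o f).
have count (Q : pred H) : #|[set v in [set: G] | Q (f v)]| = #|[set w in [set: H] | Q w]|.
  rewrite -(on_card_preimset (onW_bij _ bij_f)).
  by apply: eq_card => v; rewrite !inE.
split=> [v _|v w _ _ vw|s|s v _ sv] /=.
- by rewrite (block_size geo).
- by rewrite (block_meet geo) ?inE ?adj_f ?(inj_eq (bij_inj bij_f)).
- by rewrite (count (fun w => s \in pts w)) (point_degree geo).
- rewrite -(point_block geo (in_setT (f v)) sv) -count.
  by apply: eq_card => w; rewrite !inE adj_f.
Qed.

Lemma card_sig_set (T : finType) (A : {set T}) (Q : pred T) :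
  #|[set u : {x | x \in A} | Q (val u)]| = #|[set x in A | Q x]|.
Proof.
rewrite card_setIdE big_sub /= -sum1_card big_mkcond /=.
by apply: eq_bigr => u _; rewrite inE; case: (Q _).
Qed.

Lemma geometry_induced (G : sgraph) (N : {set G}) (P : finType)
    (pts : induced N -> {set P}) K R al :
  geometry [set: induced N] pts K R al ->
  exists pts' : G -> {set P}, geometry N pts' K R al.
Proof.
move=> geo.
pose pts' v := if insub v is Some u then pts u else set0.
have pts'E (u : induced N) : pts' (val u) = pts u by rewrite /pts' valK.
have lift v : v \in N -> exists u : induced N, v = val u.
  by move=> vN; exists (Sub v vN); rewrite SubK.
have count (Q : pred G) :
    #|[set v in N | Q v]| = #|[set u in [set: induced N] | Q (val u)]|.
  by rewrite -card_sig_set; apply: eq_card => u; rewrite !inE.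
exists pts'.
split=> [v /lift[{}v ->]|v w /lift[{}v ->] /lift[{}w ->] vw|s|s v /lift[{}v ->]].
- by rewrite pts'E (block_size geo).
- by rewrite !pts'E (block_meet geo) ?inE.
- rewrite count -(point_degree geo s).
  by apply: eq_card => u; rewrite !inE pts'E.
- rewrite pts'E => sv; rewrite count -(point_block geo (in_setT v) sv).
  by apply: eq_card => u; rewrite !inE pts'E.
Qed.

Section OrthogonalArray.
Variables (p q : nat) (A : 'M['I_q]_(p, q ^ 2)).
Hypothesis oa : orthogonal_array A.

(** A point is a row together with a symbol, and a column is on those which
    it realizes. *)
Definition oa_points (c : oa_block_graph A) : {set 'I_p * 'I_q} :=
  [set (i, A i c) | i : 'I_p].

Lemma mem_oa_points c i a : ((i, a) \in oa_points c) = (A i c == a).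
Proof. by apply/imsetP/eqP => [[j _ [-> ->]]|<-] //; exists i. Qed.

Lemma card_oa_points c : #|oa_points c| = p.
Proof. by rewrite card_imset ?card_ord // => i j []. Qed.

Lemma oa_points_meet (c d : oa_block_graph A) : c != d ->
  #|oa_points c :&: oa_points d| = adj c d.
Proof.
move=> cd; rewrite /= /oa_adj cd /=; case: existsP => [[i /eqP cdi]|no].
  apply/eqP/cards1P; exists (i, A i c); apply/setP => -[j b].
  rewrite !inE !mem_oa_points; apply/andP/eqP => [[/eqP cj /eqP dj]|[-> ->]]; last by rewrite cdi.
  have [ji|ji] := eqVneq j i; first by rewrite -cj ji.
  have /eqP/cards1P[w Ew] := oa ji b (A i c).
  have cw : c \in [set w] by rewrite -Ew inE cj !eqxx.
  have dw : d \in [set w] by rewrite -Ew inE dj cdi !eqxx.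
  by move: cd; rewrite !inE in cw dw; rewrite (eqP cw) (eqP dw) eqxx.
apply/eqP; rewrite cards_eq0; apply/set0Pn => -[[i a]].
by rewrite inE !mem_oa_points => /andP[/eqP<- /eqP E]; case: no; exists i; rewrite E.
Qed.

Lemma oa_geometry : 1 < p ->
  geometry [set: oa_block_graph A] oa_points p q p.-1.
Proof.
move=> p_gt1; split=> [c _|c d _ _|[i a]|[i a] c _ ia].
- exact: card_oa_points.
- exact: oa_points_meet.
- have [j ji] : exists j : 'I_p, j != i.
    apply/existsP; apply: contraTT p_gt1 => /existsPn all_i.
    rewrite -leqNgt -[p]card_ord -(cards1 i) -cardsT; apply/subset_leq_card/subsetP => j _.
    by rewrite inE; apply/negPn/all_i.
  transitivity (\sum_(b : 'I_q) 1); last by rewrite sum1_card card_ord.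
  rewrite [RHS](eq_bigr (fun b => #|[set c | (A j c == b) && (A i c == a)]|)); last first.
    by move=> b _; rewrite oa.
  under [RHS]eq_bigr do rewrite -sum1_card big_mkcond /=.
  rewrite exchange_big -sum1_card big_mkcond /=; apply: eq_bigr => c _.
  rewrite !inE mem_oa_points (bigD1 (A j c)) //= inE eqxx /=.
  by rewrite big1 ?addn0 // => b /negbTE bc; rewrite inE eq_sym bc.
rewrite card_point_block //; last by move=> w _; apply: oa_points_meet.
rewrite mem_oa_points in ia.
rewrite big_imset /=; last by move=> j k _ _ [].
rewrite (bigD1 i) //= (eq_bigr (fun=> 1)) ?sum1_card; last first.
  move=> j ji; apply: etrans (oa ji (A j c) a); apply: eq_card => w.
  by rewrite !inE !mem_oa_points /= andbC.
rewrite [X in X + _](_ : _ = 0); last first.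
  apply/eqP; rewrite cards_eq0; apply/set0Pn => -[w].
  by rewrite !inE !mem_oa_points /= => /andP[/eqP-> ]; rewrite eq_sym (negbTE ia).
rewrite add0n; have := cardC1 i; rewrite card_ord => <-.
by apply: eq_card => j; rewrite !inE.
Qed.

End OrthogonalArray.

Section Steiner.
Variables (p q : nat) (B : {set {set 'I_q}}).
Hypothesis st : steiner_system p B.

Definition steiner_points (b : steiner_block_graph B) : {set 'I_q} := val b.

Lemma card_steiner_points b : #|steiner_points b| = p.
Proof. by case: st => sz _; apply/sz/(valP b). Qed.

Lemma steiner_points_meet (b c : steiner_block_graph B) : b != c ->
  #|steiner_points b :&: steiner_points c| = adj b c.
Proof.
move=> bc; rewrite /= /steiner_adj bc /=.
have : #|steiner_points b :&: steiner_points c| <= 1.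
  rewrite leqNgt; apply: contra bc => /card_gt1P[x [y []]].
  rewrite !inE => /andP[xb xc] /andP[yb yc] xy.
  have /eqP/cards1P[w Ew] := proj2 st x y xy.
  have bw : val b \in [set w] by rewrite -Ew inE (valP b) xb.
  have cw : val c \in [set w] by rewrite -Ew inE (valP c) xc.
  by rewrite !inE in bw cw; rewrite -val_eqE /= (eqP bw) (eqP cw).
by rewrite -/(steiner_points b) -/(steiner_points c); case: #|_| => [|[|]].
Qed.

Lemma card_join x y : x != y ->
  #|[set b in [set: steiner_block_graph B] |
      (x \in steiner_points b) && (y \in steiner_points b)]| = 1.
Proof.
move=> xy; rewrite -(proj2 st x y xy).
rewrite -(card_sig_set B (fun b => (x \in b) && (y \in b))).
by apply: eq_card => b; rewrite !inE.
Qed.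

Lemma steiner_degree x :
  #|[set b in [set: steiner_block_graph B] | x \in steiner_points b]| * p.-1
  = q.-1.
Proof.
rewrite -sum_nat_const.
rewrite (eq_bigr (fun b => #|[set~ x] :&: steiner_points b|)); last first.
  move=> b; rewrite mem_setId => /andP[_ xb].
  have := cardsD1 x (steiner_points b); rewrite xb card_steiner_points => -> /=.
  by rewrite setIC -setDE.
rewrite double_count (eq_bigr (fun=> 1)); last first.
  move=> y; rewrite !inE eq_sym => xy; rewrite -(card_join xy).
  by apply: eq_card => b; rewrite !inE.
by rewrite sum1_card cardsC1 card_ord.
Qed.

Lemma steiner_geometry : 1 < p ->
  geometry [set: steiner_block_graph B] steiner_points p (q.-1 %/ p.-1) p.
Proof.
move=> p_gt1; split=> [b _|b c _ _|x|x b _ xb].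
- exact: card_steiner_points.
- exact: steiner_points_meet.
- by rewrite -(steiner_degree x) mulnK; lia.
rewrite card_point_block //; last by move=> w _; apply: steiner_points_meet.
rewrite (eq_bigr (fun=> 1)) ?sum1_card ?card_steiner_points //.
by move=> y yb; rewrite card_join //; apply: contraNneq xb => ->.
Qed.

Lemma steiner_block_count : 1 < p ->
  #|steiner_block_graph B| * p = q * (q.-1 %/ p.-1).
Proof.
move=> p_gt1.
have := double_count steiner_points [set: steiner_block_graph B] [set: 'I_q].
under eq_bigr do rewrite setTI card_steiner_points.
under [RHS]eq_bigr do rewrite (point_degree (steiner_geometry p_gt1)).
by rewrite !sum_nat_const !cardsT card_ord.
Qed.
End Steiner.

(** * Eigenvalues of block graphs *)

Local Open Scope ring_scope.

Lemma adj_eigenfunction (R : rcfType) (L : sgraph) (a : R) :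
  eigenvalue (adj_mx R L) a ->
  exists xi : L -> R, (exists v, xi v != 0) /\
    forall v, \sum_w xi w * (adj v w)%:R = a * xi v.
Proof.
case/eigenvalueP => u ua u0; exists (fun v => u 0 (enum_rank v)); split.
  have /rV0Pn[i ui] := u0; exists (enum_val i); by rewrite enum_valK.
move=> v; have /rowP/(_ (enum_rank v)) := ua; rewrite !mxE => <-.
rewrite (reindex_onto (@enum_val _ _) enum_rank) /=; last by move=> w _; rewrite enum_rankK.
apply: eq_big => [i|i _]; first by rewrite enum_valK eqxx.
by rewrite !mxE enum_valK enum_rankK adj_sym.
Qed.

(** If xi is an eigenfunction for - m and y s is the sum of xi over the blocks
    through s, then the sum of y over a block v is (K - m) xi v, because the
    product of the incidence matrix and its transpose is A + K I. *)
Section PointSums.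
Variables (R : rcfType) (L : sgraph) (P : finType) (pts : L -> {set P}).
Variables (K : nat) (m : R) (xi : L -> R).
Hypothesis size_pts : forall v, #|pts v| = K.
Hypothesis meet_pts : forall v w, v != w -> #|pts v :&: pts w| = adj v w.
Hypothesis xi_eigen : forall v, \sum_w xi w * (adj v w)%:R = - m * xi v.

Let y s := \sum_(v | s \in pts v) xi v.

Lemma sum_pairing (A : {pred P}) (F : L -> R) :
  \sum_(s in A) \sum_(v | s \in pts v) F v
  = \sum_v F v * (#|[pred s in A | s \in pts v]|)%:R.
Proof.
under eq_bigr do rewrite big_mkcond /=.
rewrite exchange_big /=; apply: eq_bigr => v _.
by rewrite -big_mkcondr /= sumr_const mulr_natr; congr (_ *+ _).
Qed.

Lemma sum_block v : \sum_(s in pts v) y s = (K%:R - m) * xi v.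
Proof.
rewrite /y sum_pairing mulrBl -mulNr -xi_eigen.
rewrite (bigD1 v) //= [X in _ = _ + X](bigD1 v) //= adj_irr mulr0 add0r.
congr (_ + _).
  by rewrite mulrC -(size_pts v); congr (_%:R * _); apply: eq_card => s; rewrite !inE andbb.
apply: eq_bigr => w wv; rewrite -meet_pts 1?eq_sym //; congr (_ * _%:R).
by apply: eq_card => s; rewrite !inE.
Qed.

Lemma swap_sum (F : P -> R) :
  \sum_s F s * y s = \sum_v xi v * \sum_(s in pts v) F s.
Proof.
under eq_bigr do rewrite mulr_sumr big_mkcond /=.
rewrite exchange_big /=; apply: eq_bigr => v _.
by rewrite -big_mkcond mulr_sumr; apply: eq_bigr => s _; rewrite mulrC.
Qed.

Lemma point_sums_norm : \sum_s y s ^+ 2 = (K%:R - m) * \sum_v xi v ^+ 2.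
Proof.
under eq_bigr do rewrite expr2.
rewrite swap_sum mulr_sumr; apply: eq_bigr => v _.
by rewrite sum_block mulrCA expr2.
Qed.

(** The product of the incidence matrix and its transpose is positive
    semidefinite.  This holds without the axioms on points, which fail for an
    array with a single row. *)
Lemma eigenvalue_le : (exists v, xi v != 0) -> m <= K%:R.
Proof.
case=> v xv; have pos : 0 < \sum_v xi v ^+ 2.
  rewrite (bigD1 v) //= ltr_wpDr ?sumr_ge0 // => [w _|]; first exact: sqr_ge0.
  by rewrite exprn_even_gt0.
rewrite -subr_ge0 -(pmulr_lge0 _ pos) -point_sums_norm.
by apply: sumr_ge0 => s _; apply: sqr_ge0.
Qed.

Variables (r al : nat).
Hypothesis geo : geometry [set: L] pts K r al.

(** The only eigenvalue other than - K with an eigenfunction of sum zero is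
    R - 1 - al, which cannot be below - 1 since al <= R.  In terms of y: summing
    the block sums of y over the blocks through s gives
    (R - 1 - al + m) y s = 0, so y vanishes, and then (K - m) xi = 0. *)
Lemma eigenvalue_eq : (1 < K)%N -> (1 < #|L|)%N -> 1 < m ->
  (exists v, xi v != 0) -> m = K%:R.
Proof.
move=> K_gt1 L_gt1 m_gt1 [v0 xv0].
have al_le : (al <= r)%N.
  have /card_gt1P[v [w [_ _ vw]]] := L_gt1.
  have [s sv sw] : exists2 s, s \in pts v & s \notin pts w.
    apply/subsetPn; apply: contraL K_gt1 => sub.
    have := meet_pts vw; rewrite (setIidPl sub) size_pts => ->.
    by case: (adj v w).
  rewrite -(point_degree geo s) -(point_block geo (in_setT w) sw).
  by apply/subset_leq_card/subsetP => u; rewrite !mem_setId => /and3P[-> ->].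
have r_gt0 : (0 < r)%N.
  have /card_gt0P[s sv] : (0 < #|pts v0|)%N by rewrite size_pts; lia.
  by rewrite -(point_degree geo s); apply/card_gt0P; exists v0; rewrite !inE.
pose X := \sum_v xi v.
have y_sum : \sum_s y s = K%:R * X.
  have := swap_sum (fun=> 1); under eq_bigr do rewrite mul1r.
  move=> ->; rewrite mulr_sumr; apply: eq_bigr => v _.
  by rewrite sumr_const size_pts mulrC.
(* Sum the block sums of y over all blocks. *)
have X0 : X = 0.
  have E : \sum_v \sum_(s in pts v) y s = r%:R * (K%:R * X).
    rewrite -y_sum mulr_sumr.
    under eq_bigr do rewrite big_mkcond /=.
    rewrite exchange_big /=; apply: eq_bigr => s _.
    rewrite -big_mkcond sumr_const mulr_natl -(point_degree geo s); congr (_ *+ _).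
    by apply: eq_card => v; rewrite !inE.
  move: E; under eq_bigr do rewrite sum_block.
  rewrite -mulr_sumr -/X => E.
  have : (r%:R * K%:R - K%:R + m) * X = 0.
    by move: E; lra.
  move/eqP; rewrite mulf_eq0 => /orP[|/eqP//]; rewrite gt_eqF //.
  have r1 : 1 <= r%:R :> R by rewrite ler1n.
  have K0 : 0 <= K%:R :> R by rewrite ler0n.
  by nra.
have y_eq s : (r.-1%:R + K%:R - al%:R) * y s = (K%:R - m) * y s.
  transitivity (\sum_(w | s \in pts w) \sum_(t in pts w) y t); last first.
    rewrite mulr_sumr; apply: eq_bigr => w _; exact: sum_block.
  transitivity (\sum_v xi v *
    (\sum_(w in [set w in [set: L] | s \in pts w]) #|pts v :&: pts w|)%:R).
    rewrite [RHS](eq_bigr (fun v => al%:R * xi v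
        + (if s \in pts v then (r.-1%:R + K%:R - al%:R) * xi v else 0))).
      by rewrite big_split /= -mulr_sumr -/X X0 mulr0 add0r -big_mkcond mulr_sumr.
    move=> v _; rewrite (meet_through_point geo) ?inE //.
    by case: ifP => _; rewrite ?subn1 ?natrD; ring.
  rewrite [RHS](eq_bigr (fun w => \sum_v xi v * #|pts v :&: pts w|%:R)).
    rewrite exchange_big /=; apply: eq_bigr => v _.
    rewrite natr_sum mulr_sumr; apply: eq_bigl => w; by rewrite !inE.
  move=> w _; rewrite /y sum_pairing; apply: eq_bigr => v _; congr (_ * _%:R).
  by apply: eq_card => t; rewrite !inE andbC.
have y0 s : y s = 0.
  have : (r.-1%:R - al%:R + m) * y s = 0 by have := y_eq s; lra.
  move/eqP; rewrite mulf_eq0 => /orP[|/eqP//]; rewrite gt_eqF //.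
  have : al%:R <= r.-1%:R + 1 :> R by rewrite natr1 ler_nat; lia.
  by lra.
have := sum_block v0; rewrite big1 // => /esym/eqP.
by rewrite mulf_eq0 (negbTE xv0) orbF subr_eq0 => /eqP.
Qed.

End PointSums.

Lemma eigenvalue_le_block_size (R : rcfType) (L : sgraph) (P : finType)
    (pts : L -> {set P}) (K : nat) (m : R) :
  (forall v, #|pts v| = K) ->
  (forall v w, v != w -> #|pts v :&: pts w| = adj v w) ->
  eigenvalue (adj_mx R L) (- m) -> m <= K%:R.
Proof.
by move=> size meet /adj_eigenfunction[xi [xi0 xiE]]; apply: eigenvalue_le xi0.
Qed.

Lemma eigenvalue_eq_block_size (R : rcfType) (L : sgraph) (P : finType)
    (pts : L -> {set P}) (K r al : nat) (m : R) :
  geometry [set: L] pts K r al -> (1 < K)%N -> (1 < #|L|)%N -> 1 < m ->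
  eigenvalue (adj_mx R L) (- m) -> m = K%:R.
Proof.
move=> geo K1 L1 m1 /adj_eigenfunction[xi [xi0 xiE]].
apply: (eigenvalue_eq _ _ xiE geo) => // [v|v w vw].
  by rewrite (block_size geo).
by rewrite (block_meet geo).
Qed.

Lemma card_local_graph (G : sgraph) (x : G) : #|local_graph x| = #|nbrs x|.
Proof. by rewrite card_sig; apply: eq_card => y; rewrite !inE. Qed.

Lemma isomorphic_card (G H : sgraph) : isomorphic G H -> #|G| = #|H|.
Proof. by case=> f [bij_f _]; apply: bij_eq_card bij_f. Qed.

Lemma isomorphic_eigenvalue_le (R : rcfType) (G H : sgraph) (P : finType)
    (pts : H -> {set P}) (K : nat) (m : R) :
  isomorphic G H -> (forall v, #|pts v| = K) ->
  (forall v w, v != w -> #|pts v :&: pts w| = adj v w) ->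
  eigenvalue (adj_mx R G) (- m) -> m <= K%:R.
Proof.
move=> [f [bij_f adj_f]] size meet.
apply: (eigenvalue_le_block_size (pts := pts \o f)) => [v|v w vw] /=.
  exact: size.
by rewrite meet ?adj_f // (inj_eq (bij_inj bij_f)).
Qed.

(** * Local graphs *)

Lemma oa_local_geometry (R : rcfType) (G : sgraph) (x : G) (m : R) :
  is_oa_block_graph (local_graph x) ->
  eigenvalue (adj_mx R (local_graph x)) (- m) -> 3 <= m ->
  m ^+ 2 < #|nbrs x|%:R ->
  exists (K r : nat), [/\ m = K%:R, (K.-1.+1 < r)%N &
    exists (P : finType) (pts : G -> {set P}), geometry (nbrs x) pts K r K.-1].
Proof.
move=> [p [q [A [oa iso]]]] ev m3 mk.
have p3 : (3 <= p)%N.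
  have := isomorphic_eigenvalue_le iso (card_oa_points (A := A)) (oa_points_meet oa) ev.
  by move/(le_trans m3); rewrite ler_nat.
have [pts geo] := geometry_iso iso (oa_geometry oa (ltnW p3)).
have k_q : #|nbrs x| = (q ^ 2)%N.
  by rewrite -card_local_graph (isomorphic_card iso) card_ord.
have L1 : (1 < #|local_graph x|)%N.
  by rewrite card_local_graph -(ltr_nat R); move: mk m3; nra.
have mE : m = p%:R by apply: (eigenvalue_eq_block_size geo (ltnW p3) L1 _ ev); lra.
exists p, q; split=> //.
  rewrite prednK; last by lia.
  by move: mk; rewrite mE k_q -natrX ltr_nat ltn_exp2r.
by have [pts' geo'] := geometry_induced geo; exists _, pts'.
Qed.

Lemma steiner_local_geometry (R : rcfType) (G : sgraph) (x : G) (m : R) :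
  is_steiner_block_graph (local_graph x) ->
  eigenvalue (adj_mx R (local_graph x)) (- m) -> 3 <= m ->
  m * (m + 1) < #|nbrs x|%:R ->
  exists (K r : nat), [/\ m = K%:R, (K.+1 < r)%N &
    exists (P : finType) (pts : G -> {set P}), geometry (nbrs x) pts K r K].
Proof.
move=> [p [q [B [st iso]]]] ev m3 mk.
have p3 : (3 <= p)%N.
  have := isomorphic_eigenvalue_le iso (card_steiner_points st) (steiner_points_meet st) ev.
  by move/(le_trans m3); rewrite ler_nat.
have [pts geo] := geometry_iso iso (steiner_geometry st (ltnW p3)).
have L1 : (1 < #|local_graph x|)%N.
  by rewrite card_local_graph -(ltr_nat R); move: mk m3; nra.
have mE : m = p%:R by apply: (eigenvalue_eq_block_size geo (ltnW p3) L1 _ ev); lra.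
exists p, (q.-1 %/ p.-1)%N; split=> //; last first.
  by have [pts' geo'] := geometry_induced geo; exists _, pts'.
have count := steiner_block_count st (ltnW p3).
rewrite -(isomorphic_card iso) card_local_graph in count.
move: mk; rewrite mE natr1 -natrM ltr_nat => mk.
(* A point exists, so the degree of a point times p - 1 is q - 1. *)
have /dvdnP[r Er] : (p.-1 %| q.-1)%N.
  have /card_gt0P[v _] : (0 < #|local_graph x|)%N by lia.
  have /card_gt0P[s _] : (0 < #|pts v|)%N.
    by rewrite (block_size geo (in_setT v)); lia.
  case: iso geo => f _ _.
  have /card_gt0P[t _] : (0 < #|steiner_points (f v)|)%N.
    by rewrite (card_steiner_points st); lia.
  by apply/dvdnP; eexists; rewrite -(steiner_degree st t).
move: count; rewrite Er mulnK; last by lia.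
(* If r <= p + 1, then q <= p^2, and k p = q r <= p^2 (p + 1). *)
move=> count; rewrite ltnNge; apply/negP => rp.
have qE : q = (r * p.-1).+1 by rewrite -Er; case: (q) count => //; lia.
have : (p * p.+1 * p < q * r)%N by rewrite -count ltn_pmul2r //; lia.
have : (q <= p * p)%N by rewrite qE; case: (p) p3 rp => // p' _ /=; nia.
by move=> *; nia.
Qed.

Theorem theorem1p2 (R : rcfType) (G : sgraph)
    (p : nat -> nat -> nat -> nat) (m : R) :
  distance_regular G p ->
  (3 <= diameter G)%N ->
  (forall x : G,
      (exists nu kappa lambda mu : nat,
          strongly_regular (local_graph x) nu kappa lambda mu) /\
      smallest_eigenvalue (local_graph x) (- m)) ->
  3 <= m ->
  (exists gamma : nat, triple_intersection_number G gamma) ->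
  ((forall x : G, is_oa_block_graph (local_graph x)) ->
     m ^+ 2 < (valency p)%:R ->
     (inter_c p 2)%:R <> m ^+ 2) /\
  ((forall x : G, is_steiner_block_graph (local_graph x)) ->
     m * (m + 1) < (valency p)%:R ->
     (inter_c p 2)%:R <> m * (m + 1)).
Proof.
move=> dr D3 loc m3 gam.
have ev (x : G) : eigenvalue (adj_mx R (local_graph x)) (- m) by case: (loc x) => _ [].
have valencyE (x : G) : valency p = #|nbrs x|.
  rewrite /valency /inter_b -(proj2 dr 0%N 1%N 1%N _ _ _ x x) ?dist_xx //; try lia.
  by rewrite setIid sphere1.
have [_ [[x0 _] _]] := gam.
have no_geometry (al : nat -> nat) :
    (forall x : G, exists K r : nat, [/\ m = K%:R, ((al K).+1 < r)%N &
       exists (P : finType) (pts : G -> {set P}),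
         geometry (nbrs x) pts K r (al K)]) ->
    (forall K, (2 < K)%N -> (K <= (al K).+1)%N) ->
    (forall K, (2 < K)%N -> m = K%:R ->
       (inter_c p 2)%:R = (K * (al K).+1)%:R :> R) -> False.
  move=> geo al_ge c2.
  have [K [r0 [mE _ _]]] := geo x0.
  have K3 : (2 < K)%N by move: m3; rewrite mE ler_nat.
  apply: (@distance_regular_not_locally_geometric G p K (al K)) => //.
  - exact: al_ge.
  - by apply/eqP; rewrite -(eqr_nat R) (c2 K).
  move=> x; have [K' [r [mE' rK [P [pts g]]]]] := geo x.
  (* The block size is m at every vertex. *)
  have KK' : K' = K by apply/eqP; rewrite -(eqr_nat R) -mE -mE'.
  by rewrite KK' in g rK; exists P, pts, r.
split=> block_graph mk c2.
  apply: (no_geometry predn) => [x|[]//|[//|K] _ mE].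
    by apply: oa_local_geometry => //; rewrite -valencyE.
  by rewrite c2 mE expr2 natrM.
apply: (no_geometry id) => [x|//|K _ mE].
  by apply: steiner_local_geometry => //; rewrite -valencyE.
by rewrite c2 mE natrM natr1.
Qed.
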